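(* Let $\mathcal{F}$ be a foliation on $\mathbb{CP}^2$ of degree $d\ge 2$ with a finite abelian group of automorphisms and a unique singular point, and let $m$ be the algebraic multiplicity of $\mathcal{F}$ at this singular point. If one of the following conditions is satisfied, then $\mathcal{F}$ is stable: (i) $m\le\frac{d-1}{3}$; or (ii) $\frac{d-1}{3}<m\le\frac{d}{2}$ and $\mathcal{F}$ has no invariant lines.
   Context: Let $W_d$ be the complex vector space of homogeneous vector fields $P\,\partial/\partial x+Q\,\partial/\partial y+R\,\partial/\partial z$ with $P,Q,R\in\mathbb{C}[x,y,z]$ homogeneous of degree $d$, modulo the fields $G\cdot(x\,\partial/\partial x+y\,\partial/\partial y+z\,\partial/\partial z)$ with $G$ homogeneous of degree $d-1$. A foliation of degree $d$ on $\mathbb{CP}^2$ is a point of $\mathcal{F}(d;2)=\mathbb{P}(W_d)\cong\mathbb{CP}^{d^2+4d+2}$. The group $SL_3(\mathbb{C})$ acts linearly by $g\cdot X=Dg\,X(g^{-1})$. The automorphism group of a foliation is its stabilizer in $SL_3(\mathbb{C})$ for the action on $\mathcal{F}(d;2)$. A point $p\in\mathbb{CP}^2$ is a singular point of the foliation defined by $X$ if $X(p)=\alpha p$ for some $\alpha\in\mathbb{C}$ (as vectors in $\mathbb{C}^3$). In the affine chart $x=1$ around $[1:0:0]$ the foliation is represented by the local vector field $f\,\partial/\partial y+g\,\partial/\partial z$, where $f=Q(1,y,z)-yP(1,y,z)$ and $g=R(1,y,z)-zP(1,y,z)$; similarly, by a linear change of coordinates, at every point. The algebraic multiplicity at a singular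 point $p$, translated to the origin of the chart, is the minimum of the orders of vanishing of $f$ and $g$ at the origin. An irreducible plane curve $F(x,y,z)=0$ is invariant under the foliation defined by $X=P\,\partial/\partial x+Q\,\partial/\partial y+R\,\partial/\partial z$ if there is a polynomial $H(x,y,z)$ with $P\,\frac{\partial F}{\partial x}+Q\,\frac{\partial F}{\partial y}+R\,\frac{\partial F}{\partial z}=F\,H$; an invariant line is such a curve with $F$ of degree $1$. For a one-parameter subgroup (1-PS) $\lambda:\mathbb{C}^*\to SL_3(\mathbb{C})$, choose a basis $\nu_0,\dots,\nu_n$ of $W_d$ with $\lambda(t)\nu_i=t^{r_i}\nu_i$, $r_i\in\mathbb{Z}$. For a foliation represented by $\sum a_i\nu_i$, the Mumford function is $\mu(\mathcal{F},\lambda)=\min\{r_i: a_i\ne 0\}$. The foliation $\mathcal{F}$ is stable if $\mu(\mathcal{F},\lambda)<0$ for every non-trivial 1-PS $\lambda$ of $SL_3(\mathbb{C})$. *)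

(* Defs.v *)
From mathcomp Require Import all_boot all_order all_algebra.
From mathcomp Require Import classical_sets cardinality reals.
From mathcomp Require Import complex mpoly.

Set Implicit Arguments.
Unset Strict Implicit.
Unset Printing Implicit Defensive.

Import Order.TTheory GRing.Theory Num.Theory.
Local Open Scope ring_scope.

Definition is_least {disp : Order.disp_t} {T : porderType disp}
    (S : set T) (m : T) : Prop :=
  S m /\ forall k, S k -> (m <= k)%O.

Section VectorFields.
Variable C : fieldType.

(* The column (P, Q, R)^T encodes P d/dx + Q d/dy + R d/dz, where x, y, z are
   'X_0, 'X_1, 'X_2. *)
Definition vfield := 'cV[{mpoly C[3]}]_3.

Definition homogeneous (d : nat) (X : vfield) : Prop :=
  forall i, X i 0 \is d.-homog.

Definition euler : vfield := \col_i 'X_i.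

(* Equality of classes in W_d. *)
Definition eqW (d : nat) (X Y : vfield) : Prop :=
  exists2 G : {mpoly C[3]}, G \is d.-1.-homog & X - Y = G *: euler.

(* X represents a point of P(W_d). *)
Definition foliation (d : nat) (X : vfield) : Prop :=
  homogeneous d X /\ ~ eqW d X 0.

(* g . X = Dg X(g^-1) *)
Definition vf_act (g : 'M[C]_3) (X : vfield) : vfield :=
  let ginv := [tuple \sum_j (invmx g i j)%:MP * 'X_j | i < 3] in
  map_mx (fun c => c%:MP) g *m map_mx (fun p => p \mPo ginv) X.

Definition is_automorphism (d : nat) (X : vfield) (g : 'M[C]_3) : Prop :=
  \det g = 1 /\ exists2 c : C, c != 0 & eqW d (vf_act g X) (c%:MP *: X).

Definition automorphism_group (d : nat) (X : vfield) : set 'M[C]_3 :=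
  is_automorphism d X.

(* Points of CP^2 are nonzero columns, up to a scalar. *)
Definition vf_eval (X : vfield) (p : 'cV[C]_3) : 'cV[C]_3 :=
  map_mx (fun P => P.@[fun i => p i 0]) X.

Definition singular_point (X : vfield) (p : 'cV[C]_3) : Prop :=
  p != 0 /\ exists alpha : C, vf_eval X p = alpha *: p.

Definition unique_singular_point (X : vfield) (p : 'cV[C]_3) : Prop :=
  singular_point X p /\
  forall q, singular_point X q -> exists c : C, q = c *: p.

(* Restriction to the chart x = 1; the affine coordinates y, z are
   'X_0, 'X_1 of {mpoly C[2]}. *)
Definition dehomog (P : {mpoly C[3]}) : {mpoly C[2]} :=
  P \mPo [tuple 1; 'X_0; 'X_1].

Definition local_f (X : vfield) : {mpoly C[2]} :=
  dehomog (X 1 0) - 'X_0 * dehomog (X 0 0).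

Definition local_g (X : vfield) : {mpoly C[2]} :=
  dehomog (X 2%:R 0) - 'X_1 * dehomog (X 0 0).

(* No k satisfies this for p = 0, whose order of vanishing is infinite. *)
Definition vanishing_order (p : {mpoly C[2]}) (k : nat) : Prop :=
  is_least [set mdeg mon | mon in [set` msupp p]]%classic k.

(* The linear change of coordinates g moves [1 : 0 : 0] to p. *)
Definition algebraic_multiplicity (X : vfield) (p : 'cV[C]_3) (m : nat) : Prop :=
  exists g : 'M[C]_3,
    [/\ g \in unitmx, col 0 g = p &
        let Y := vf_act (invmx g) X in
        is_least (vanishing_order (local_f Y) `|` vanishing_order (local_g Y))%classic
          m].

Definition invariant_curve (X : vfield) (F : {mpoly C[3]}) : Prop :=
  exists H : {mpoly C[3]}, \sum_i X i 0 * F^`M(i) = F * H.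

(* Nonzero linear forms are irreducible, so irreducibility is not repeated. *)
Definition invariant_line (X : vfield) (F : {mpoly C[3]}) : Prop :=
  [/\ F != 0, F \is 1.-homog & invariant_curve X F].

(* A morphism of algebraic groups from C^* to SL_3: the entries are Laurent
   polynomials in t. The value at t = 0 is irrelevant. *)
Definition one_param_subgroup (lambda : C -> 'M[C]_3) : Prop :=
  [/\ forall t, t != 0 -> \det (lambda t) = 1,
      forall s t, s != 0 -> t != 0 -> lambda (s * t) = lambda s *m lambda t &
      exists (N : nat) (L : 'M[{poly C}]_3),
        forall t, t != 0 -> forall i j, lambda t i j = (L i j).[t] / t ^+ N].

Definition nontrivial_1PS (lambda : C -> 'M[C]_3) : Prop :=
  exists2 t, t != 0 & lambda t != 1%:M.

Definition lin_comb (n : nat) (a : 'I_n -> C) (nu : 'I_n -> vfield) : vfield :=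
  \sum_i (a i)%:MP *: nu i.

Definition is_basisW (d n : nat) (nu : 'I_n -> vfield) : Prop :=
  [/\ forall i, homogeneous d (nu i),
      forall a, eqW d (lin_comb a nu) 0 -> forall i, a i = 0 &
      forall Y, homogeneous d Y -> exists a, eqW d Y (lin_comb a nu)].

Definition is_mumford (d : nat) (X : vfield) (lambda : C -> 'M[C]_3) (mu : int) :
    Prop :=
  exists (n : nat) (nu : 'I_n -> vfield) (r : 'I_n -> int) (a : 'I_n -> C),
    [/\ is_basisW d nu,
        forall t i, t != 0 -> eqW d (vf_act (lambda t) (nu i)) ((t ^ r i)%:MP *: nu i),
        eqW d X (lin_comb a nu) &
        is_least [set r i | i in [set i | a i != 0]]%classic mu].

Definition stable (d : nat) (X : vfield) : Prop :=
  forall lambda, one_param_subgroup lambda -> nontrivial_1PS lambda ->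
    exists2 mu : int, is_mumford d X lambda mu & mu < 0.

End VectorFields.

(* Main.v *)
Require Import Defs.
From mathcomp Require Import all_boot all_order all_algebra.
From mathcomp Require Import classical_sets cardinality reals.
From mathcomp Require Import complex mpoly.
From mathcomp Require Import perm zify ring lra.

(** The proof is the numerical criterion applied by hand.

A one-parameter subgroup is diagonal, with entries t ^ n_j, in the coordinates
given by the columns of some matrix h, which may be ordered so that
n_0 >= n_1 >= n_2; the determinant gives n_0 + n_1 + n_2 = 0
([one_param_subgroup_sorted_diag]).  In these coordinates the field
x^a d/dx_i is an eigenvector of weight n_i - (a_0 n_0 + a_1 n_1 + a_2 n_2).
Dropping the multiples of x d/dx, which are redundant modulo the Euler field,
leaves an eigenbasis of W_d, so the Mumford function mu exists and X is h.Y in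
W_d for some Y all of whose monomials have weight at least mu
([is_mumford_diag]).

Suppose that mu >= 0.  Three consequences of the nonnegativity of the weights
of Y contradict the hypotheses.

- Since n_0 > 0 and d >= 2, no pure power of x occurs in the last two components
  of Y, so [1 : 0 : 0] is singular for Y and h [1 : 0 : 0] is the singular
  point p.  If n_1 = n_0, the same argument makes [0 : 1 : 0] singular too,
  contradicting uniqueness; hence n_1 < n_0.

- The order of vanishing at p does not depend on the coordinates
  ([algebraic_multiplicity_lt]), so some monomial of Y vanishes to order at most
  m at [1 : 0 : 0].  Its weight is at most
  n_1 - d n_0 + m (n_0 - n_2) = (m + 1) n_1 - (d - 2 m) n_0 ([weight_lt0]).
  This is negative if 3 m + 1 <= d, because n_1 < n_0, and also if 2 m <= d and
  n_1 < 0.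

- If n_1 >= 0, then n_2 < 0 and every monomial of the third component of Y is
  divisible by z: the line z = 0 is invariant ([invariant_line_coordinate]).
  Without invariant lines this leaves only n_1 < 0. *)

Set Implicit Arguments.
Unset Strict Implicit.
Unset Printing Implicit Defensive.

Import Order.TTheory GRing.Theory Num.Theory.
Local Open Scope ring_scope.

(** * Diagonalization of one-parameter subgroups *)

Lemma poly_eq_nonzero (F : numFieldType) (p q : {poly F}) :
  (forall t, t != 0 -> p.[t] = q.[t]) -> p = q.
Proof.
move=> pq; apply/eqP; rewrite -subr_eq0; apply/negP => /negP nz.
pose s := [seq k.+1%:R : F | k <- iota 0 (size (p - q))].
have: (size s < size (p - q)%R)%N.
  apply: max_poly_roots => //.
    apply/allP => _ /mapP[k _ ->]; apply/rootP.
    by rewrite hornerD hornerN pq ?subrr// pnatr_eq0.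
  rewrite map_inj_uniq ?iota_uniq// => i j /eqP.
  by rewrite eqr_nat => /eqP[].
by rewrite size_map size_iota ltnn.
Qed.

Lemma idempotent_diagonalizable (F : fieldType) (n : nat) (A : 'M[F]_n.+1) :
  A *m A = A -> diagonalizable A.
Proof.
move=> AA; apply/diagonalizableP; exists [:: 0; 1].
  by rewrite /= inE eq_sym oner_eq0.
apply: mxminpoly_min; rewrite big_cons big_seq1 subr0.
by rewrite rmorphM rmorphB/= horner_mx_X horner_mx_C -!mulmxE mulmxBr mulmx1 AA subrr.
Qed.

(** Comparing the coefficients of s ^ k t ^ l on both sides of
lambda (s t) = lambda s lambda t shows that the Laurent coefficients of lambda
are orthogonal idempotents; they sum to lambda 1, which is the identity because
it is an invertible idempotent. *)
Lemma one_param_subgroup_idempotents (F : numFieldType) (lambda : F -> 'M[F]_3) :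
  one_param_subgroup lambda ->
  exists (N K : nat) (B : nat -> 'M[F]_3),
    [/\ forall t, t != 0 -> lambda t = t ^- N *: \sum_(k < K) t ^+ k *: B k,
        forall k l, (k < K)%N -> (l < K)%N -> B k *m B l = (k == l)%:R *: B l &
        \sum_(k < K) B k = 1%:M].
Proof.
case=> det1 lamM [N [L lamL]].
pose K := \max_i \max_j size (L i j).
pose B k := \matrix_(i, j) (L i j)`_k.
have szL i j : (size (L i j) <= K)%N.
  by apply: leq_trans (leq_bigmax i); apply: (leq_bigmax j).
have lamE t : t != 0 -> lambda t = t ^- N *: \sum_(k < K) t ^+ k *: B k.
  move=> t0; apply/matrixP => i j; rewrite !mxE lamL// mulrC summxE; congr (_ * _).
  rewrite (horner_coef_wide _ (szL i j)); apply: eq_bigr => k _.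
  by rewrite !mxE mulrC.
have lam1 : lambda 1 = 1%:M.
  have u : lambda 1 \in unitmx by rewrite unitmxE det1 ?oner_eq0// unitr1.
  have := lamM 1 1 (oner_neq0 _) (oner_neq0 _); rewrite mulr1 => e.
  by rewrite -[LHS](mulKmx u) -e mulVmx.
(* First separate the powers of t, with s fixed; then those of s. *)
have BB s l : s != 0 -> (l < K)%N -> s ^+ l *: B l = \sum_(k < K) s ^+ k *: (B k *m B l).
  move=> s0 lK; apply/matrixP => i j.
  pose p := \poly_(l < K) (s ^+ l * B l i j).
  pose q := \poly_(l < K) (\sum_(k < K) s ^+ k *: (B k *m B l)) i j.
  have : p = q.
    apply: poly_eq_nonzero => t t0; rewrite !horner_poly.
    have st0 : s * t != 0 by rewrite mulf_neq0.
    have := lamM s t s0 t0; rewrite !lamE// -scalemxAl -scalemxAr scalerA.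
    rewrite -invfM -exprMn => /(scalerI _) /matrixP/(_ i j) H.
    have {H} := H (invr_neq0 (expf_neq0 _ st0)).
    rewrite summxE => H; transitivity (\sum_(k < K) ((s * t) ^+ k *: B k) i j).
      by apply: eq_bigr => k _; rewrite !mxE exprMn; ring.
    rewrite H mulmx_sumr summxE; apply: eq_bigr => k _.
    rewrite -scalemxAr mulmx_suml !mxE mulrC; congr (_ * _).
    by rewrite !summxE; apply: eq_bigr => m _; rewrite -scalemxAl.
  move/polyP/(_ l); rewrite !coef_poly lK => <-.
  by rewrite !mxE.
exists N, K, B; split => //.
  move=> k l kK lK; apply/matrixP => i j.
  pose p := \poly_(k < K) ((k == l)%:R * B l i j).
  pose q := \poly_(k < K) (B k *m B l) i j.
  have : p = q.
    apply: poly_eq_nonzero => s s0; rewrite !horner_poly.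
    have /matrixP/(_ i j) := BB s l s0 lK.
    rewrite mxE summxE => H.
    rewrite (bigD1 (Ordinal lK))//= eqxx mul1r big1 ?addr0; last first.
      by move=> m /negbTE; rewrite -val_eqE/= => ->; rewrite !mul0r.
    by rewrite mulrC H; apply: eq_bigr => m _; rewrite mxE mulrC.
  by move/polyP/(_ k); rewrite !coef_poly kK => <-; rewrite !mxE.
rewrite -lam1 lamE ?oner_eq0// expr1n invr1 scale1r.
by apply: eq_bigr => k _; rewrite expr1n scale1r.
Qed.

(** The coefficients of lambda commute and are diagonalizable, hence
diagonalizable in one basis.  On each basis vector exactly one of them acts as 1
and the others as 0, and that one carries the exponent of t. *)
Lemma one_param_subgroup_diag (F : numFieldType) (lambda : F -> 'M[F]_3) :
  one_param_subgroup lambda ->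
  exists2 h, h \in unitmx & exists n : 'I_3 -> int,
    forall t, t != 0 -> lambda t *m h = h *m diag_mx (\row_j t ^ n j).
Proof.
move=> /one_param_subgroup_idempotents [N [K [B [lamE BB B1]]]].
have [P Pu /allP PB] : codiagonalizable [seq B k | k <- iota 0 K].
  apply/codiagonalizableP; split.
    move=> _ _ /mapP[k + ->] /mapP[l + ->]; rewrite !mem_iota /= !add0n => kK lK.
    by rewrite /comm_mx !BB// eq_sym; case: eqP => [->//|_]; rewrite !scale0r.
  move=> _ /mapP[k + ->]; rewrite mem_iota /= add0n => kK.
  by apply: idempotent_diagonalizable; rewrite BB// eqxx scale1r.
have PBd k : (k < K)%N -> exists D : 'rV_3, P *m B k = diag_mx D *m P.
  move=> kK; have /PB/diagonalizable_forPex[D] : B k \in [seq B k | k <- iota 0 K].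
    by apply/mapP; exists k; rewrite ?mem_iota.
  by move/(simmxP Pu) => ?; exists D.
pose D k j := (P *m B k *m invmx P) j j.
have {}PBd k : (k < K)%N -> P *m B k = diag_mx (\row_j D k j) *m P.
  move=> kK; have [E PE] := PBd k kK; rewrite PE; congr (diag_mx _ *m _).
  by apply/rowP => j; rewrite !mxE /D PE mulmxK// mxE eqxx.
have DD k l j : (k < K)%N -> (l < K)%N -> D k j * D l j = (k == l)%:R * D l j.
  move=> kK lK; have /(congr1 (mulmx P)) := BB k l kK lK.
  rewrite mulmxA PBd// -mulmxA PBd// mulmxA -scalemxAr PBd// scalemxAl.
  move/(congr1 (mulmx^~ (invmx P))); rewrite !mulmxK// => /matrixP/(_ j j).
  by rewrite mul_diag_mx !mxE eqxx !mulr1n.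
have D1 j : \sum_(k < K) D k j = 1.
  have /(congr1 (mulmx P)) := B1; rewrite mulmx1 mulmx_sumr => /(congr1 (mulmx^~ (invmx P))).
  rewrite mulmxV// => /matrixP/(_ j j); rewrite [X in _ = X -> _]mxE eqxx mulr1n.
  rewrite mulmx_suml summxE => <-.
  by apply: eq_bigr => k _.
clearbody D.
have kapP j : exists k : 'I_K, D k j != 0.
  apply/existsP; rewrite -[X in is_true X]negbK negb_exists; apply/negP => /forallP D0.
  have := D1 j; rewrite big1 => [/eqP|k _]; first by rewrite eq_sym oner_eq0.
  by apply/eqP; rewrite -[_ == _]negbK D0.
(* The exponent of t in direction j, before the shift by N. *)
pose kap j := xchoose (kapP j).
have DE (k : 'I_K) j : D k j = (k == kap j)%:R.
  have kapn0 : D (kap j) j != 0 := xchooseP (kapP j).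
  apply: (mulIf kapn0); rewrite DD//.
exists (invmx P); first by rewrite unitmx_inv.
exists (fun j => (kap j)%:Z - N%:Z) => t t0.
rewrite -[LHS](mulKmx Pu); congr (_ *m _).
rewrite mulmxA; apply: (canLR (mulmxK Pu)).
rewrite lamE// -scalemxAr mulmx_sumr.
apply/matrixP => i j; rewrite mul_diag_mx [LHS]mxE summxE [RHS]mxE [in RHS]mxE.
rewrite (bigD1 (kap i))//= -scalemxAr PBd// mxE mul_diag_mx !mxE DE eqxx mul1r.
rewrite big1 ?addr0 ?expfzDr// => [|k kk]; last first.
  by rewrite -scalemxAr PBd// mxE mul_diag_mx !mxE DE (negbTE kk) mul0r mulr0.
by rewrite -exprnN mulrA [_^-1 * _]mulrC.
Qed.

Lemma sort_weights (n : 'I_3 -> int) :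
  exists s : 'S_3, n (s 1) <= n (s 0) /\ n (s 2%:R) <= n (s 1).
Proof.
pose t := [tuple n i | i < 3].
have /tuple_permP[s es] : perm_eq (sort >=%R t) t by rewrite perm_sort.
have srt : sorted >=%R (sort >=%R t) by apply: sort_sorted => x y; exact: le_total.
have l1 : lift ord0 ord0 = 1 :> 'I_3 by apply: val_inj.
have l2 : lift ord0 (lift ord0 ord0) = 2%:R :> 'I_3 by apply: val_inj.
exists s; move: srt; rewrite es /= !enum_ordSl /= => /and3P[].
by rewrite !tnth_mktuple l2 l1.
Qed.

Lemma exprz2_eq1 (F : numFieldType) (z : int) : 2%:R ^ z = 1 :> F -> z = 0.
Proof.
have pos k : 2%:R ^+ k = 1 :> F -> k = 0%N.
  move/eqP; rewrite -natrX -[1]/(1%:R) eqr_nat.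
  by case: k => // k; rewrite expnS => /eqP; lia.
case: z => [k /pos-> //|k]; rewrite NegzE -exprnN => /eqP.
by rewrite invr_eq1 => /eqP/pos.
Qed.

Lemma one_param_subgroup_sorted_diag (F : numFieldType) (lambda : F -> 'M[F]_3) :
  one_param_subgroup lambda ->
  exists2 h, h \in unitmx & exists n : 'I_3 -> int,
    [/\ forall t, t != 0 -> lambda t *m h = h *m diag_mx (\row_j t ^ n j),
        n 1 <= n 0, n 2%:R <= n 1 & n 0 + n 1 + n 2%:R = 0].
Proof.
move=> lam; have [h hu [n lamh]] := one_param_subgroup_diag lam.
have [s [s1 s2]] := sort_weights n.
exists (col_perm s h).
  by rewrite col_permE unitmx_mul hu unitmx_perm.
exists (n \o s); split => //= [t t0|].
  apply/matrixP => i j; rewrite mul_mx_diag !mxE.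
  have /matrixP/(_ i (s j)) := lamh t t0; rewrite mul_mx_diag !mxE => <-.
  by apply: eq_bigr => k _; rewrite mxE.
have two0 : 2%:R != 0 :> F by rewrite pnatr_eq0.
have hd : \det h != 0 by rewrite -unitfE -unitmxE.
(* An integer power of 2 determines its exponent in characteristic 0. *)
have /(congr1 determinant) := lamh 2%:R two0.
case: lam => det1 _ _; rewrite !det_mulmx det1// mul1r det_diag -[LHS]mulr1.
move/(mulfI hd)/esym.
rewrite (reindex_inj (@perm_inj _ s)) !big_ord_recl big_ord0 /= !mxE mulr1.
have -> : ord0 = 0 :> 'I_3 by apply: val_inj.
have -> : lift 0 ord0 = 1 :> 'I_3 by apply: val_inj.
have -> : lift 0 (lift ord0 ord0) = 2%:R :> 'I_3 by apply: val_inj.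
by rewrite -!expfzDr// addrA => /exprz2_eq1.
Qed.

(** * The action as a substitution *)

Definition const_mpoly_mx (C : fieldType) (k m n : nat) (A : 'M[C]_(m, n)) :
  'M[{mpoly C[k]}]_(m, n) := map_mx (fun c => c%:MP) A.

(** The value of the vector field at a point with polynomial coordinates.  Taking
q over two variables as well as three lets one definition serve for the linear
changes of coordinates and for the affine chart. *)
Definition vsubst (C : fieldType) (k : nat) (q : 'cV[{mpoly C[k]}]_3) (X : vfield C) :
  'cV[{mpoly C[k]}]_3 := map_mx (fun P => P \mPo [tuple q i 0 | i < 3]) X.

Section Substitution.
Variable C : fieldType.
Implicit Types (X Y : vfield C) (g h : 'M[C]_3) (G : {mpoly C[3]}).

Lemma comp_mpolyA (n k l : nat) (P : {mpoly C[n]}) (lp : n.-tuple {mpoly C[k]})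
    (lq : k.-tuple {mpoly C[l]}) :
  (P \mPo lp) \mPo lq = P \mPo [tuple tnth lp i \mPo lq | i < n].
Proof.
rewrite !(comp_mpolyE P) raddf_sum; apply: eq_bigr => m _ /=.
rewrite comp_mpolyZ rmorph_prod; congr (_ *: _); apply: eq_bigr => i _.
by rewrite rmorphXn tnth_mktuple.
Qed.

Lemma const_mpoly_mxM (k m n p : nat) (A : 'M[C]_(m, n)) (B : 'M[C]_(n, p)) :
  const_mpoly_mx k (A *m B) = const_mpoly_mx k A *m const_mpoly_mx k B.
Proof. exact: (map_mxM (@mpolyC k C)). Qed.

Lemma const_mpoly_mx1 (k n : nat) : const_mpoly_mx k (1%:M : 'M[C]_n) = 1%:M.
Proof. exact: (map_mx1 (@mpolyC k C)). Qed.

Lemma vsubst_mul (k : nat) (q : 'cV[{mpoly C[k]}]_3) g X :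
  vsubst q (const_mpoly_mx 3 g *m X) = const_mpoly_mx k g *m vsubst q X.
Proof.
rewrite /vsubst (map_mxM (comp_mpoly _)); congr (_ *m _).
by apply/matrixP => i j; rewrite !mxE /= comp_mpolyC.
Qed.

Lemma vsubst_comp (l : nat) (q : 'cV[{mpoly C[l]}]_3) (r : 'cV[{mpoly C[3]}]_3) X :
  vsubst q (vsubst r X) = vsubst (vsubst q r) X.
Proof.
apply/colP => i; rewrite !mxE comp_mpolyA; congr comp_mpoly.
by apply: eq_from_tnth => j; rewrite !tnth_mktuple mxE.
Qed.

Lemma vsubst_euler (k : nat) (q : 'cV[{mpoly C[k]}]_3) : vsubst q (euler C) = q.
Proof. by apply/colP => i; rewrite !mxE comp_mpolyXU -tnth_nth tnth_mktuple. Qed.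

Lemma vsubst_id X : vsubst (euler C) X = X.
Proof.
apply/colP => i; rewrite mxE -[RHS]comp_mpoly_id; congr comp_mpoly.
by apply: eq_from_tnth => j; rewrite !tnth_mktuple mxE.
Qed.

Lemma vsubstD (k : nat) (q : 'cV[{mpoly C[k]}]_3) X Y :
  vsubst q (X + Y) = vsubst q X + vsubst q Y.
Proof. exact: (map_mxD (comp_mpoly _)). Qed.

Lemma vsubstZ (k : nat) (q : 'cV[{mpoly C[k]}]_3) G X :
  vsubst q (G *: X) = (G \mPo [tuple q i 0 | i < 3]) *: vsubst q X.
Proof. exact: (map_mxZ (comp_mpoly _)). Qed.

(** The coordinate functions of g^-1. *)
Definition inverse_forms g : 'cV[{mpoly C[3]}]_3 := const_mpoly_mx 3 (invmx g) *m euler C.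

(** With [const_mpoly_mxM], this reduces every computation with the action to
matrix algebra: substituting commutes with constant matrices ([vsubst_mul]) and
is associative ([vsubst_comp]). *)
Lemma vf_actE g X : vf_act g X = const_mpoly_mx 3 g *m vsubst (inverse_forms g) X.
Proof.
rewrite /vf_act; congr (_ *m _); apply/colP => i; rewrite !mxE.
congr comp_mpoly; apply: eq_from_tnth => j; rewrite !tnth_mktuple mxE.
by apply: eq_bigr => k _; rewrite !mxE.
Qed.

Lemma vf_act_comp g h X : g \in unitmx -> h \in unitmx ->
  vf_act g (vf_act h X) = vf_act (g *m h) X.
Proof.
move=> gu hu; rewrite !vf_actE vsubst_mul mulmxA.
rewrite -(const_mpoly_mxM 3 g h).
rewrite vsubst_comp.
have ghu : g *m h \in unitmx by rewrite unitmx_mul gu.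
suff -> : vsubst (inverse_forms g) (inverse_forms h) = inverse_forms (g *m h) by [].
rewrite /inverse_forms vsubst_mul vsubst_euler mulmxA.
rewrite -(const_mpoly_mxM 3 (invmx h)).
congr (const_mpoly_mx _ _ *m _).
rewrite -[RHS]mul1mx; apply: (canRL (mulmxK ghu)).
by rewrite mulmxA mulmxKV// mulVmx.
Qed.

Lemma vf_act1 X : vf_act 1%:M X = X.
Proof.
by rewrite vf_actE const_mpoly_mx1 mul1mx /inverse_forms invmx1 const_mpoly_mx1 mul1mx vsubst_id.
Qed.

Lemma vf_actK g X : g \in unitmx -> vf_act g (vf_act (invmx g) X) = X.
Proof. by move=> gu; rewrite vf_act_comp ?unitmx_inv// mulmxV// vf_act1. Qed.

Lemma vf_actD g X Y : vf_act g (X + Y) = vf_act g X + vf_act g Y.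
Proof. by rewrite !vf_actE vsubstD mulmxDr. Qed.

Lemma vf_actZ g G X :
  vf_act g (G *: X) = (G \mPo [tuple inverse_forms g i 0 | i < 3]) *: vf_act g X.
Proof. by rewrite !vf_actE vsubstZ scalemxAr. Qed.

Lemma vf_actZC g c X : vf_act g (c%:MP *: X) = c%:MP *: vf_act g X.
Proof. by rewrite vf_actZ comp_mpolyC. Qed.

Lemma vf_act0 g : vf_act g 0 = 0.
Proof. by rewrite -(scale0r 0) -mpolyC0 vf_actZC mpolyC0 !scale0r. Qed.

Lemma vf_act_sum g (I : Type) (r : seq I) (F : I -> vfield C) :
  vf_act g (\sum_(i <- r) F i) = \sum_(i <- r) vf_act g (F i).
Proof. exact: (big_morph _ (vf_actD g) (vf_act0 g)). Qed.

(** This is why the action descends to W_d. *)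
Lemma vf_act_euler g : g \in unitmx -> vf_act g (euler C) = euler C.
Proof.
move=> gu; rewrite vf_actE vsubst_euler /inverse_forms mulmxA -const_mpoly_mxM.
by rewrite mulmxV// const_mpoly_mx1 mul1mx.
Qed.

Lemma dhomog_comp_linear (n k d : nat) (P : {mpoly C[n]}) (lq : n.-tuple {mpoly C[k]}) :
  (forall i, tnth lq i \is 1.-homog) -> P \is d.-homog -> P \mPo lq \is d.-homog.
Proof.
move=> lin /dhomogP Pd; rewrite comp_mpolyE big_seq; apply: rpred_sum => m /Pd <-.
apply: rpredZ.
suff : \prod_(i < n) tnth lq i ^+ m i \is (\sum_(i < n) m i)%N.-homog by rewrite -mdegE.
elim/big_rec2: _ => [|i e p _ ih]; first exact: dhomog1.
by apply: dhomogM ih; rewrite -[X in X.-homog]mul1n; apply: dhomogMn.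
Qed.

Lemma inverse_forms_homog g i : inverse_forms g i 0 \is 1.-homog.
Proof.
rewrite mxE; apply: rpred_sum => j _; rewrite !mxE mul_mpolyC.
by apply: rpredZ; rewrite dhomogX; apply/eqP; exact: mdeg1.
Qed.

Lemma dhomog_comp_inverse_forms g d G :
  G \is d.-homog -> G \mPo [tuple inverse_forms g i 0 | i < 3] \is d.-homog.
Proof.
by apply: dhomog_comp_linear => i; rewrite tnth_mktuple inverse_forms_homog.
Qed.

Lemma homogeneous_vf_act g d X : homogeneous d X -> homogeneous d (vf_act g X).
Proof.
move=> Xd i; rewrite vf_actE mxE; apply: rpred_sum => j _; rewrite !mxE mul_mpolyC.
by apply/rpredZ/dhomog_comp_inverse_forms.
Qed.

Lemma eqW_refl d X : eqW d X X.
Proof. by exists 0; rewrite ?rpred0// subrr scale0r. Qed.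

Lemma eqW_vf_act g d X Y : g \in unitmx ->
  eqW d X Y -> eqW d (vf_act g X) (vf_act g Y).
Proof.
move=> gu [G Gd /(canRL (subrK _)) ->].
exists (G \mPo [tuple inverse_forms g i 0 | i < 3]); first exact: dhomog_comp_inverse_forms.
by rewrite vf_actD vf_actZ vf_act_euler// addrK.
Qed.

Lemma vf_eval_act g X (p : 'cV[C]_3) : g \in unitmx ->
  vf_eval (vf_act g X) (g *m p) = g *m vf_eval X p.
Proof.
move=> gu; apply/colP => i; rewrite vf_actE !mxE rmorph_sum; apply: eq_bigr => j _ /=.
rewrite !mxE mevalM mevalC comp_mpoly_meval; congr (_ * _); apply: meval_eq => k.
rewrite tnth_mktuple mxE rmorph_sum -[p in RHS](mulKmx gu) mxE; apply: eq_bigr => l _ /=.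
by rewrite !mxE mevalM mevalC mevalXU mxE.
Qed.

End Substitution.

(** * Weights of monomial vector fields *)

Section Weights.
Variable C : fieldType.
Implicit Types (X Y Z : vfield C) (g h : 'M[C]_3) (G : {mpoly C[3]}) (n : 'I_3 -> int).

Definition weight n (m : 'X_{1..3}) (i : 'I_3) : int := n i - \sum_j (m j)%:Z * n j.

Definition monomial_field (u : 'X_{1..3} * 'I_3) : vfield C :=
  \col_i ('X_[u.1] *+ (i == u.2)).

Lemma vf_act_diag_monomial n (t : C) u : t != 0 ->
  vf_act (diag_mx (\row_j t ^ n j)) (monomial_field u)
    = (t ^ weight n u.1 u.2)%:MP *: monomial_field u.
Proof.
move=> t0; set D := diag_mx _.
have DV : invmx D = diag_mx (\row_j t ^ (- n j)).
  have DM : D *m diag_mx (\row_j t ^ (- n j)) = 1%:M.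
    rewrite mulmx_diag -diag_const_mx; congr diag_mx; apply/rowP => j.
    by rewrite !mxE -expfzDr// subrr.
  have Du : D \in unitmx by case: (mulmx1_unit DM).
  by rewrite -[RHS](mulKmx Du) DM mulmx1.
apply/colP => i; rewrite vf_actE mxE (bigD1 i)//= big1 ?addr0; last first.
  by move=> j ji; rewrite /const_mpoly_mx !mxE eq_sym (negbTE ji) mul0r.
rewrite !mxE eqxx mulr1n; have [->|ni] := eqVneq i u.2; last first.
  by rewrite !mulr0n comp_mpoly0 !mulr0.
rewrite !mulr1n comp_mpolyX /weight expfzDr// mpolyCM -mulrA; congr (_ * _).
have exprz_sum (f : 'I_3 -> int) : t ^ (\sum_j f j) = \prod_j t ^ f j.
  by apply: (big_morph (fun z : int => t ^ z)) => // x y; rewrite expfzDr.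
rewrite [in RHS]mpolyXE_id -sumrN exprz_sum (rmorph_prod (@mpolyC 3 C)) -big_split.
apply: eq_bigr => j _ /=; rewrite tnth_mktuple /inverse_forms mxE (bigD1 j)//=.
rewrite big1 ?addr0 => [|k kj]; last first.
  by rewrite DV /const_mpoly_mx !mxE eq_sym (negbTE kj) mul0r.
rewrite DV /const_mpoly_mx !mxE eqxx mulr1n exprMn; congr (_ * _).
by rewrite -rmorphXn /= exprnP exprz_exp mulNr mulrC.
Qed.

(** The monomial fields left once the multiples of x d/dx are discarded: modulo
the Euler field, x G d/dx is - (y G d/dy + z G d/dz). *)
Definition reduced (u : 'X_{1..3} * 'I_3) : bool := (u.2 != 0) || (u.1 0 == 0%N).

(** Bases of W_d are families indexed by an ordinal, hence this enumeration. *)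
Lemma enum_reduced_monomials (d : nat) :
  exists (N : nat) (e : 'I_N -> 'X_{1..3} * 'I_3), injective e /\
    forall u, (mdeg u.1 == d) && reduced u <-> exists j, e j = u.
Proof.
pose A := [set u : 'X_{1..3 < d.+1} * 'I_3 | (mdeg u.1 == d) && reduced (val u.1, u.2)].
exists #|A|, (fun j => (val (enum_val j).1, (enum_val j).2)); split.
  move=> i j [/val_inj e1 e2]; apply: enum_val_inj.
  by case: (enum_val i) (enum_val j) e1 e2 => [? ?] [? ?] /= -> ->.
move=> [m i]; split => /= [mi|[j [<- <-]]]; last first.
  by have := enum_valP j; rewrite inE.
have md : (mdeg m < d.+1)%N by case/andP: mi => /eqP->.
have mA : (BMultinom md, i) \in A by rewrite inE.
by exists (enum_rank_in mA (BMultinom md, i)); rewrite enum_rankK_in.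
Qed.

Lemma lin_comb_monomial_coeff (N : nat) (e : 'I_N -> 'X_{1..3} * 'I_3) (a : 'I_N -> C) m i :
  (lin_comb a (monomial_field \o e) i 0)@_m = \sum_j a j * (e j == (m, i))%:R.
Proof.
rewrite /lin_comb summxE raddf_sum; apply: eq_bigr => j _ /=.
rewrite !mxE mcoeffCM mcoeffMn mcoeffX; case: (e j) => m' i' /=.
by rewrite xpair_eqE [i' == i]eq_sym; case: (_ == _); case: (_ == _).
Qed.

Definition reduced_field Z := forall m, m \in msupp (Z 0 0) -> m 0 = 0%N.

(** The multiplier of the Euler field is the sum of the terms of the first
component divisible by x, each divided by x. *)
Lemma euler_reduction (d : nat) Y : (0 < d)%N -> homogeneous d Y ->
  exists Z, [/\ homogeneous d Z, eqW d Y Z & reduced_field Z].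
Proof.
move=> d0 Yd.
pose G : {mpoly C[3]} := \sum_(m <- msupp (Y 0 0) | m 0 != 0%N) (Y 0 0)@_m *: 'X_[m - U_(0)].
have GX : G * 'X_0 = \sum_(m <- msupp (Y 0 0) | m 0 != 0%N) (Y 0 0)@_m *: 'X_[m].
  rewrite mulr_suml; apply: eq_bigr => m m0; rewrite -scalerAl -mpolyXD submK//.
  by rewrite lep1mP.
have Gd : G \is d.-1.-homog.
  rewrite /G big_seq_cond; apply: rpred_sum => m /andP[ms m0]; apply: rpredZ.
  rewrite dhomogX; apply/eqP; have /dhomogP/(_ m ms) /= := Yd 0.
  have : (U_(0%R) <= m)%MM by rewrite lep1mP.
  move/submK => {1}<-; rewrite mdegD mdeg1; lia.
exists (Y - G *: euler C); split.
- move=> i; rewrite !mxE; apply: rpredB => //.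
  suff : G * 'X_i \is (d.-1 + 1)%N.-homog by rewrite addn1 (prednK d0).
  apply: dhomogM => //.
  by rewrite dhomogX; apply/eqP; exact: mdeg1.
- by exists G => //; rewrite opprB addrC subrK.
- move=> m; rewrite !mxE GX.
  have -> : Y 0 0 - \sum_(m <- msupp (Y 0 0) | m 0 != 0%N) (Y 0 0)@_m *: 'X_[m]
     = \sum_(m <- msupp (Y 0 0) | m 0 == 0%N) (Y 0 0)@_m *: 'X_[m].
    by rewrite {1}[Y 0 0]mpolyE (bigID (fun m : 'X_{1..3} => m 0 == 0%N))/= addrK.
  move/msupp_sum_le/flattenP => [s /mapP[m' + ->]].
  rewrite mem_filter => /andP[/eqP m'0 _] /msuppZ_le.
  by rewrite msuppX inE => /eqP->.
Qed.

End Weights.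

(** * The Mumford function in diagonalizing coordinates *)

Section Mumford.
Variable C : fieldType.
Implicit Types (X Y Z : vfield C) (g h : 'M[C]_3) (G : {mpoly C[3]}) (n : 'I_3 -> int).

(** A multiple G E of the Euler field has first component x G, which contains no
monomial free of x unless G is zero. *)
Lemma reduced_eqW0 (d : nat) Z : reduced_field Z -> eqW d Z 0 -> Z = 0.
Proof.
move=> Zr [G _]; rewrite subr0 => ZG.
suff G0 : G = 0 by rewrite ZG G0 scale0r.
apply/mpolyP => m; rewrite mcoeff0; apply/eqP/negP => /negP Gm.
have /Zr : (U_(0%R) + m)%MM \in msupp (Z 0 0).
  by rewrite mcoeff_msupp ZG !mxE mcoeffMX.
by rewrite mnmDE mnm1E eqxx.
Qed.

Lemma reduced_expansion (d N : nat) (e : 'I_N -> 'X_{1..3} * 'I_3) Z :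
  injective e -> (forall u, (mdeg u.1 == d) && reduced u <-> exists j, e j = u) ->
  homogeneous d Z -> reduced_field Z ->
  Z = lin_comb (fun j => (Z (e j).2 0)@_(e j).1) (@monomial_field C \o e).
Proof.
move=> einj eP Zd Zr; apply/colP => i; apply/mpolyP => m.
rewrite lin_comb_monomial_coeff.
have [mi|mi] := boolP ((mdeg m == d) && reduced (m, i)).
  have [j ej] := (eP (m, i)).1 mi.
  rewrite (bigD1 j)//= ej eqxx mulr1 big1 ?addr0// => k kj.
  by rewrite -ej (inj_eq einj) (negbTE kj) mulr0.
rewrite big1 => [|j _]; last first.
  by case: eqP => [ej|]; rewrite ?mulr0//; case/negP: mi; apply/(eP (m, i)); exists j.
apply/eqP; rewrite -[_ == _]negbK -mcoeff_msupp; apply/negP => ms.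
case/negP: mi; have /dhomogP/(_ m ms) /= -> := Zd i; rewrite eqxx /reduced /=.
by case: eqP ms => //= -> /Zr ->.
Qed.

Lemma lin_comb_vf_act h (N : nat) (a : 'I_N -> C) (nu : 'I_N -> vfield C) :
  lin_comb a (vf_act h \o nu) = vf_act h (lin_comb a nu).
Proof. by rewrite /lin_comb vf_act_sum; apply: eq_bigr => j _; rewrite vf_actZC. Qed.

(** The images under h of the reduced monomial fields form an eigenbasis of W_d for
lambda, and mu is the least weight of a monomial of the reduced representative
Y of h^-1 X. *)
Lemma is_mumford_diag (d : nat) X (lambda : C -> 'M[C]_3) h n :
  (0 < d)%N -> h \in unitmx -> (forall t, t != 0 -> \det (lambda t) = 1) ->
  (forall t, t != 0 -> lambda t *m h = h *m diag_mx (\row_j t ^ n j)) ->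
  foliation d X ->
  exists mu, is_mumford d X lambda mu /\ exists Y,
    [/\ homogeneous d Y, eqW d X (vf_act h Y) &
        forall i m, m \in msupp (Y i 0) -> mu <= weight n m i].
Proof.
move=> d0 hu det1 lamh [Xd Xn0].
have hVu : invmx h \in unitmx by rewrite unitmx_inv.
have [N [e [einj eP]]] := enum_reduced_monomials d.
have norm Y : homogeneous d Y -> exists Z, [/\ homogeneous d Z, eqW d Y (vf_act h Z),
    reduced_field Z & Z = lin_comb (fun j => (Z (e j).2 0)@_(e j).1) (@monomial_field C \o e)].
  move=> /(homogeneous_vf_act (invmx h)) Yd.
  have [Z [Zd YZ Zr]] := euler_reduction d0 Yd.
  exists Z; split => //; last exact: reduced_expansion eP Zd Zr.
  by rewrite -[Y](vf_actK (g:=h))//; exact: eqW_vf_act.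
have [Z [Zd XZ Zr Ze]] := norm X Xd.
pose a j := (Z (e j).2 0)@_(e j).1.
pose r j := weight n (e j).1 (e j).2.
have [j0 aj0] : exists j, a j != 0.
  apply/existsP; rewrite -[X in is_true X]negbK negb_exists; apply/negP => /forallP a0.
  apply: Xn0; move: XZ; rewrite Ze /lin_comb big1 ?vf_act0// => j _.
  by have /negPn/eqP := a0 j; rewrite /a => ->; rewrite mpolyC0 scale0r.
case: (@arg_minP _ _ _ j0 (fun j => a j != 0) r aj0) => j1 aj1 rmin.
exists (r j1); split; last first.
  exists Z; split => // i m ms.
  have [j ej] : exists j, e j = (m, i).
    apply/(eP (m, i)); have /dhomogP/(_ m ms) /= -> := Zd i; rewrite eqxx /=.
    by rewrite /reduced /=; case: eqP ms => //= -> /Zr ->.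
  have := rmin j; rewrite /a /r ej /=; apply.
  by rewrite -mcoeff_msupp.
exists N, (vf_act h \o (@monomial_field C \o e)), r, a; split.
- split.
  + move=> j; apply: homogeneous_vf_act => i; rewrite mxE; apply: rpredMn.
    have /andP[/eqP <- _] := (eP (e j)).2 (ex_intro _ j erefl).
    by rewrite dhomogX.
  + move=> b; rewrite lin_comb_vf_act => /(eqW_vf_act hVu).
    rewrite vf_act0 vf_act_comp// mulVmx// vf_act1 => b0 j.
    have {}b0 : lin_comb b (@monomial_field C \o e) = 0.
      apply: reduced_eqW0 b0 => m.
      rewrite mcoeff_msupp lin_comb_monomial_coeff => nz.
      apply/eqP; move: nz; apply: contraNT => m0.
      rewrite big1// => k _; case: eqP => [ek|]; rewrite ?mulr0//.
      have := (eP (m, 0)).2 (ex_intro _ k ek).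
      by rewrite /reduced /= (negbTE m0) andbF.
    have /(congr1 (mcoeff (e j).1)) := congr1 (fun Y : vfield C => Y (e j).2 0) b0.
    rewrite lin_comb_monomial_coeff mxE mcoeff0 (bigD1 j)//= -surjective_pairing.
    rewrite eqxx mulr1 big1 ?addr0// => k kj.
    by rewrite (inj_eq einj) (negbTE kj) mulr0.
  + move=> Y /norm[W [_ YW _ We]].
    by exists (fun j => (W (e j).2 0)@_(e j).1); rewrite lin_comb_vf_act -We.
- move=> t j t0 /=.
  have lu : lambda t \in unitmx by rewrite unitmxE det1// unitr1.
  have Du : diag_mx (\row_j t ^ n j) \in unitmx.
    by rewrite unitmxE det_diag; apply: rpred_prod => k _; rewrite mxE unitfE expfz_neq0.
  rewrite vf_act_comp// lamh// -(vf_act_comp (g:=h))// vf_act_diag_monomial// vf_actZC.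
  exact: eqW_refl.
- by rewrite lin_comb_vf_act -Ze.
- split; first by exists j1.
  by move=> _ [j aj <-]; exact: rmin.
Qed.

End Mumford.

(** * Singular points and invariant lines read off from monomials *)

Section SingularPoints.
Variable C : fieldType.
Implicit Types (X Y Z : vfield C) (g h : 'M[C]_3) (G : {mpoly C[3]}) (n : 'I_3 -> int).

(** Adding G times the Euler field moves the value at a point along that point, so
it changes only the scalar in the definition of a singular point. *)
Lemma singular_point_transport (d : nat) X Y h (p : 'cV[C]_3) :
  h \in unitmx -> eqW d X (vf_act h Y) -> singular_point Y p ->
  singular_point X (h *m p).
Proof.
move=> hu [G _ /(canRL (subrK _)) ->] [p0 [alpha Yp]]; split.
  by apply: contraNneq p0 => hp0; rewrite -[p](mulKmx hu) hp0 mulmx0.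
exists (alpha + G.@[fun i => (h *m p) i 0]).
rewrite scalerDl scalemxAr -Yp -(vf_eval_act _ _ hu) addrC.
by apply/colP => i; rewrite !mxE mevalD mevalM mevalXU mxE.
Qed.

Lemma meval_coordinate_point (d : nat) (P : {mpoly C[3]}) (k : 'I_3) :
  P \is d.-homog -> (U_(k) *+ d)%MM \notin msupp P ->
  P.@[fun i => (delta_mx k 0 : 'cV[C]_3) i 0] = 0.
Proof.
move=> /dhomogP Pd Pk; rewrite mevalE big_seq big1// => m ms.
have [j /andP[jk mj]] : exists j, (j != k) && (m j != 0%N).
  apply/existsP; apply: contraNT Pk; rewrite negb_exists => /forallP m0.
  suff -> : (U_(k) *+ d)%MM = m by [].
  have {}m0 j : j != k -> m j = 0%N.
    by move=> jk; have := m0 j; rewrite jk negbK => /eqP.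
  have := Pd m ms => /=; rewrite mdegE (bigD1 k)//= big1 ?addn0 => [|//] <-.
  apply/mnmP => j; rewrite mulmnE mnm1E; have [<-|kj] := eqVneq k j.
    by rewrite mul1n.
  by rewrite mul0n m0// eq_sym.
by rewrite (bigD1 j)//= mxE (negbTE jk) expr0n (negbTE mj) mul0r mulr0.
Qed.

(** At the coordinate point of index k, only the monomials x_k ^ d survive. *)
Lemma singular_coordinate_point (d : nat) Y (k : 'I_3) :
  homogeneous d Y ->
  (forall i, i != k -> (U_(k) *+ d)%MM \notin msupp (Y i 0)) ->
  singular_point Y (delta_mx k 0).
Proof.
move=> Yd Yk; split.
  apply/negP => /eqP/colP/(_ k)/eqP.
  by rewrite !mxE !eqxx oner_eq0.
exists ((Y k 0).@[fun i => (delta_mx k 0 : 'cV[C]_3) i 0]).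
apply/colP => i; rewrite [LHS]mxE [RHS]mxE [in X in _ = _ * X]mxE eqxx andbT.
have [->|ik] := eqVneq i k; first by rewrite mulr1.
by rewrite mulr0; apply: meval_coordinate_point (Yd i) (Yk i ik).
Qed.

Lemma weight_pure_power n (d : nat) (k i : 'I_3) :
  weight n (U_(k) *+ d)%MM i = n i - d%:Z * n k.
Proof.
rewrite /weight (bigD1 k)//= big1 ?addr0 => [|j jk].
  by rewrite mulmnE mnm1E eqxx mul1n.
by rewrite mulmnE mnm1E eq_sym (negbTE jk) mul0n mul0r.
Qed.

(** The monomial x_k ^ d of the component of index i has weight n_i - d n_k, which is
at most (1 - d) n_k < 0. *)
Lemma singular_coordinate_point_weight (d : nat) Y n (k : 'I_3) :
  (2 <= d)%N -> homogeneous d Y -> 0 < n k -> (forall i, n i <= n k) ->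
  (forall i m, m \in msupp (Y i 0) -> 0 <= weight n m i) ->
  singular_point Y (delta_mx k 0).
Proof.
move=> d2 Yd nk0 nk wY; apply: singular_coordinate_point Yd _ => i _.
apply/negP => /wY; rewrite weight_pure_power; have := nk i; nia.
Qed.

End SingularPoints.

Section InvariantLine.
Variable C : fieldType.
Implicit Types (X Y Z : vfield C) (g h : 'M[C]_3) (G : {mpoly C[3]}) (n : 'I_3 -> int).

Lemma mpolyX_factor (P : {mpoly C[3]}) (k : 'I_3) :
  (forall m, m \in msupp P -> m k != 0%N) -> exists H, P = H * 'X_k.
Proof.
move=> Pk; exists (\sum_(m <- msupp P) P@_m *: 'X_[m - U_(k)]).
rewrite {1}[P]mpolyE mulr_suml big_seq [RHS]big_seq; apply: eq_bigr => m /Pk mk.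
by rewrite -scalerAl -mpolyXD submK// lep1mP.
Qed.

Lemma mderiv_inverse_forms h (k j : 'I_3) :
  (inverse_forms h k 0)^`M(j) = (invmx h k j)%:MP.
Proof.
rewrite mxE raddf_sum (bigD1 j)//= big1 ?addr0 => [|i ij].
  have UU : (U_(j) - U_(j))%MM = 0%MM :> 'X_{1..3} by apply/mnmP => i; rewrite mnmBE subnn mnm0E.
  by rewrite !mxE mul_mpolyC mderivZ mderivX mnm1E eqxx UU mpolyX0 /= scale1r alg_mpolyC.
by rewrite !mxE mul_mpolyC mderivZ mderivX mnm1E (negbTE ij) /= scale0r scaler0.
Qed.

Lemma inverse_forms_neq0 h (k : 'I_3) : h \in unitmx -> inverse_forms h k 0 != 0.
Proof.
move=> hu; apply/negP => /eqP F0.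
have hk j : invmx h k j = 0.
  apply/eqP; rewrite -(mpolyC_eq0 3); apply/eqP.
  by rewrite -mderiv_inverse_forms F0 mderiv0.
have /matrixP/(_ k k)/eqP := mulVmx hu.
rewrite !mxE eqxx big1 => [|j _]; first by rewrite eq_sym oner_eq0.
by rewrite hk mul0r.
Qed.

(** The derivative of the linear form F = x_k o h^-1 along X is the component of
index k of h^-1 X.  That component is Y_k o h^-1 up to a multiple of F from the
Euler field, and F divides it when x_k divides Y_k. *)
Lemma invariant_line_coordinate (d : nat) X Y h (k : 'I_3) :
  h \in unitmx -> eqW d X (vf_act h Y) ->
  (forall m, m \in msupp (Y k 0) -> m k != 0%N) ->
  exists F, invariant_line X F.
Proof.
move=> hu [G _ /(canRL (subrK _)) XE] /mpolyX_factor[H YkE].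
exists (inverse_forms h k 0); split; [exact: inverse_forms_neq0|exact: inverse_forms_homog|].
exists (G + (H \mPo [tuple inverse_forms h i 0 | i < 3])).
transitivity ((const_mpoly_mx 3 (invmx h) *m X) k 0).
  by rewrite [RHS]mxE; apply: eq_bigr => i _; rewrite mderiv_inverse_forms mulrC [in RHS]mxE.
rewrite XE vf_actE mulmxDr mulmxA -(const_mpoly_mxM _ (invmx h)) mulVmx//.
rewrite const_mpoly_mx1 mul1mx -scalemxAr -/(inverse_forms h) mxE.
rewrite [X in X + _]mxE [X in _ + X]mxE YkE rmorphM/= comp_mpolyXU -tnth_nth tnth_mktuple.
by rewrite -mulrDl mulrC.
Qed.

End InvariantLine.

(** * Algebraic multiplicity in arbitrary coordinates *)

Section Multiplicity.
Variable C : fieldType.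
Implicit Types (X Y Z : vfield C) (g h : 'M[C]_3) (G : {mpoly C[3]}) (n : 'I_3 -> int).
Implicit Types (f : {mpoly C[2]}) (q : 'cV[{mpoly C[2]}]_3).

(** Membership in the r-th power of the ideal of the origin of the chart. *)
Definition order_ge (r : nat) f : Prop := forall m, m \in msupp f -> (r <= mdeg m)%N.

Lemma order_ge0 r : order_ge r (0 : {mpoly C[2]}).
Proof. by move=> m; rewrite msupp0. Qed.

Lemma order_ge_leq r s f : (s <= r)%N -> order_ge r f -> order_ge s f.
Proof. by move=> sr fr m /fr; apply: leq_trans. Qed.

Lemma order_geD r f1 f2 : order_ge r f1 -> order_ge r f2 -> order_ge r (f1 + f2).
Proof. by move=> r1 r2 m /msuppD_le; rewrite mem_cat => /orP[/r1|/r2]. Qed.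

Lemma order_geN r f : order_ge r f -> order_ge r (- f).
Proof. by move=> rf m; rewrite (perm_mem (msuppN _)); exact: rf. Qed.

Lemma order_geM r s f1 f2 : order_ge r f1 -> order_ge s f2 -> order_ge (r + s) (f1 * f2).
Proof.
move=> r1 s2 m /msuppM_le/allpairsP[[m1 m2] /= [/r1 m1r /s2 m2s ->]].
by rewrite mdegD leq_add.
Qed.

Lemma order_geMl s f1 f2 : order_ge s f2 -> order_ge s (f1 * f2).
Proof. by move=> s2; rewrite -[s]add0n; apply: order_geM. Qed.

Lemma order_geMr s f1 f2 : order_ge s f1 -> order_ge s (f1 * f2).
Proof. by rewrite mulrC; exact: order_geMl. Qed.

Lemma order_ge_sum (I : Type) (s : seq I) (P : pred I) (F : I -> {mpoly C[2]}) r :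
  (forall i, P i -> order_ge r (F i)) -> order_ge r (\sum_(i <- s | P i) F i).
Proof. by move=> FP; elim/big_ind: _ => //; [exact: order_ge0 | exact: order_geD]. Qed.

Lemma order_geX r f k : order_ge r f -> order_ge (k * r) (f ^+ k).
Proof.
move=> fr; elim: k => [|k ih]; first by rewrite mul0n.
by rewrite exprS mulSn; apply: order_geM.
Qed.

(** The order of vanishing of a monomial at [1 : 0 : 0]. *)
Definition transverse_degree (m : 'X_{1..3}) : nat := m 1%R + m 2%:R.

Lemma order_ge_comp r q (P : {mpoly C[3]}) :
  (forall i, i != 0 -> order_ge 1 (q i 0)) ->
  (forall m, m \in msupp P -> (r <= transverse_degree m)%N) ->
  order_ge r (P \mPo [tuple q i 0 | i < 3]).
Proof.
move=> q1 Pr; rewrite comp_mpolyE big_seq; apply: order_ge_sum => m /Pr rm.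
rewrite -mul_mpolyC; apply: order_geMl; apply: (order_ge_leq rm).
rewrite !big_ord_recl big_ord0 mulr1; apply: order_geMl.
rewrite !tnth_mktuple /transverse_degree.
have -> : lift ord0 ord0 = 1 :> 'I_3 by apply: val_inj.
have -> : lift ord0 (lift ord0 ord0) = 2%:R :> 'I_3 by apply: val_inj.
by apply: order_geM; rewrite -[X in order_ge X]muln1; apply: order_geX; apply: q1.
Qed.

(** The 2 x 2 minors of the matrix with columns q and q'.  For q = X(q') they are
the components of the bivector of X and the Euler field, whose order of
vanishing at a point is independent of the coordinates. *)
Definition wedge q q' : 'M[{mpoly C[2]}]_3 := q *m q'^T - q' *m q^T.

Lemma wedgeE q q' i j : wedge q q' i j = q i 0 * q' j 0 - q' i 0 * q j 0.
Proof. by rewrite !mxE !big_ord1 !mxE. Qed.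

Lemma wedge_mul g q q' :
  wedge (const_mpoly_mx 2 g *m q) (const_mpoly_mx 2 g *m q')
    = const_mpoly_mx 2 g *m wedge q q' *m (const_mpoly_mx 2 g)^T.
Proof. by rewrite /wedge !trmx_mul !mulmxA mulmxBr mulmxBl !mulmxA. Qed.

(** The minors see only the class of the vector field modulo the Euler field. *)
Lemma wedgeDZ q q' f : wedge (q + f *: q') q' = wedge q q'.
Proof.
rewrite /wedge mulmxDl [(q + _)^T]linearD /= [(_ *: _)^T]linearZ /= mulmxDr.
by rewrite -scalemxAl -scalemxAr opprD addrACA subrr addr0.
Qed.

Definition chart_point : 'cV[{mpoly C[2]}]_3 := \col_i tnth [tuple 1; 'X_0; 'X_1] i.

Lemma dehomogE (P : {mpoly C[3]}) : dehomog P = P \mPo [tuple chart_point i 0 | i < 3].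
Proof.
rewrite /dehomog; congr comp_mpoly; apply: eq_from_tnth => i.
by rewrite tnth_mktuple mxE.
Qed.

Lemma local_f_wedge X : local_f X = wedge (vsubst chart_point X) chart_point 1 0.
Proof. by rewrite wedgeE /local_f !dehomogE !mxE /= mulr1. Qed.

Lemma local_g_wedge X : local_g X = wedge (vsubst chart_point X) chart_point 2%:R 0.
Proof. by rewrite wedgeE /local_g !dehomogE !mxE /= mulr1. Qed.

(** In the minor of indices i and j, each term pairs a component of Y with a
coordinate of the other index.  So the first component of Y, where a degree is
lost in the bound, is always multiplied by one of the two coordinates that
vanish at the origin. *)
Lemma order_ge_wedge r Y q :
  (forall i, i != 0 -> order_ge 1 (q i 0)) ->
  (forall i m, m \in msupp (Y i 0) -> (r <= transverse_degree m + (i == 0%R))%N) ->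
  forall i j, order_ge r (wedge (vsubst q Y) q i j).
Proof.
move=> q1 Yr.
have prod i j : i != j -> order_ge r (vsubst q Y i 0 * q j 0).
  move=> ij; rewrite mxE; have [i0|i0] := eqVneq i 0; last first.
    apply/order_geMr/order_ge_comp => // m /Yr.
    by rewrite (negbTE i0) addn0.
  (* An inequality, not an equality, because r may be 0. *)
  have rr : (r <= r.-1 + 1)%N by lia.
  apply: (order_ge_leq rr); apply: order_geM; last by apply: q1; rewrite -i0 eq_sym.
  by apply: order_ge_comp => // m /Yr; rewrite i0 eqxx; lia.
move=> i j; rewrite wedgeE; have [->|ij] := eqVneq i j.
  by rewrite [X in X - _]mulrC mulrC subrr; exact: order_ge0.
apply: order_geD; first exact: prod.
by apply: order_geN; rewrite mulrC; apply: prod; rewrite eq_sym.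
Qed.

(** Coordinates g computing the multiplicity at p differ from the coordinates h by a
matrix k.  The minors of g^-1 X on the chart are k W k^T, where W are the minors
of Y along a parametrized neighbourhood q of [1 : 0 : 0]; so if the monomials of
Y made the entries of W vanish to order m + 1, the equations of the foliation in
the first chart would vanish to that order too. *)
Lemma algebraic_multiplicity_lt (d m : nat) X Y h (p : 'cV[C]_3) (c : C) :
  h \in unitmx -> eqW d X (vf_act h Y) -> c != 0 -> h *m delta_mx 0 0 = c *: p ->
  algebraic_multiplicity X p m ->
  ~ (forall i mon, mon \in msupp (Y i 0) -> (m < transverse_degree mon + (i == 0%R))%N).
Proof.
move=> hu XY c0 hp [g [gu gp]] /=; set Z := vf_act _ X => -[mZ _] Ym.
pose k := invmx g *m h; pose T := invmx h *m g.
have ku : k \in unitmx by rewrite unitmx_mul unitmx_inv gu.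
have kT : k *m T = 1%:M by rewrite /k /T mulmxA mulmxK// mulVmx.
have kV : invmx k = T by rewrite -[RHS](mulKmx ku) kT mulmx1.
(* Both g and h send [1 : 0 : 0] to p, so the inverse T of k fixes it. *)
have T0 i : i != 0 -> T i 0 = 0.
  move=> i0; suff -> : T i 0 = (c^-1 *: (delta_mx 0 0 : 'cV[C]_3)) i 0.
    by rewrite !mxE (negbTE i0) mulr0.
  rewrite -(mulKmx hu (delta_mx 0 0)) hp -scalemxAr scalerA mulVf// scale1r -gp.
  by rewrite colE mulmxA -colE [RHS]mxE.
pose q := const_mpoly_mx 2 T *m chart_point.
have q1 i : i != 0 -> order_ge 1 (q i 0).
  move=> i0; rewrite mxE (bigD1 0)//= [const_mpoly_mx 2 T i 0]mxE T0// mpolyC0 mul0r add0r.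
  apply: order_ge_sum => j j0; apply: order_geMl.
  have Xk (l : 'I_2) : order_ge 1 ('X_l : {mpoly C[2]}).
    by move=> m'; rewrite msuppX inE => /eqP->; rewrite mdeg1.
  rewrite mxE; case: j j0 => [[|[|[|//]]] ?] // _; [exact: (Xk 0)|exact: (Xk 1)].
have [G _ ZE] : eqW d Z (vf_act k Y).
  have gVu : invmx g \in unitmx by rewrite unitmx_inv.
  by rewrite -(vf_act_comp _ gVu hu); exact: eqW_vf_act XY.
have ZW : wedge (vsubst chart_point Z) chart_point =
   const_mpoly_mx 2 k *m wedge (vsubst q Y) q *m (const_mpoly_mx 2 k)^T.
  rewrite -(subrK (vf_act k Y) Z) ZE vsubstD vsubstZ vsubst_euler addrC wedgeDZ.
  rewrite vf_actE vsubst_mul vsubst_comp /inverse_forms vsubst_mul vsubst_euler kV.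
  rewrite -wedge_mul -/q; congr (wedge _ _).
  by rewrite /q mulmxA -(const_mpoly_mxM 2 k) -kV mulmxV// const_mpoly_mx1 mul1mx.
have ZWm i j : order_ge m.+1 (wedge (vsubst chart_point Z) chart_point i j).
  rewrite ZW mxE; apply: order_ge_sum => a _; apply: order_geMr.
  rewrite mxE; apply: order_ge_sum => b _; apply: order_geMl.
  exact: order_ge_wedge.
by case: mZ => -[[mon /=]]; rewrite ?local_f_wedge ?local_g_wedge => /ZWm lt_m mdegE';
   move: lt_m; rewrite mdegE' ltnn.
Qed.

End Multiplicity.

(** * The stability criterion *)

Lemma weightE n (m : 'X_{1..3}) i :
  weight n m i = n i - ((m 0)%:Z * n 0 + (m 1)%:Z * n 1 + (m 2%:R)%:Z * n 2%:R).
Proof.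
rewrite /weight !big_ord_recl big_ord0 addr0 addrA; congr (_ - (_ + _ * n _ + _ * n _)).
- by congr (Posz (m _)); apply: val_inj.
- by apply: val_inj.
- by congr (Posz (m _)); apply: val_inj.
- by apply: val_inj.
Qed.

Lemma mdeg_transverse (m : 'X_{1..3}) : mdeg m = (m 0%R + transverse_degree m)%N.
Proof.
rewrite mdegE !big_ord_recl big_ord0 addn0 /transverse_degree.
by congr (_ + (m _ + m _))%N; apply: val_inj.
Qed.

Lemma ord3_cases (P : 'I_3 -> Prop) : P 0 -> P 1 -> P 2%:R -> forall i, P i.
Proof.
move=> P0 P1 P2 [[|[|[|//]]] lt_i].
- by rewrite (_ : Ordinal lt_i = 0)//; apply: val_inj.
- by rewrite (_ : Ordinal lt_i = 1)//; apply: val_inj.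
- by rewrite (_ : Ordinal lt_i = 2%:R)//; apply: val_inj.
Qed.

(** Under the last hypothesis, as n_0 >= n_1 >= n_2, the weight is bounded by that of
the monomial x^(d - k) z^k in the second component, which is the expression
assumed to be negative. *)
Lemma weight_lt0 n (d k : nat) (m : 'X_{1..3}) (i : 'I_3) :
  n 1 <= n 0 -> n 2%:R <= n 1 -> mdeg m = d ->
  n 1 - d%:Z * n 0 + k%:Z * (n 0 - n 2%:R) < 0 ->
  (transverse_degree m + (i == 0%R) <= k)%N -> weight n m i < 0.
Proof.
move=> n01 n12 md neg mk; apply: le_lt_trans neg; rewrite weightE.
move: md mk; rewrite mdeg_transverse /transverse_degree.
set a := m 0; set b := m 1; set c := m 2%:R => md mk.
have b_ge0 : 0 <= b%:Z * (n 1 - n 2%:R) by rewrite mulr_ge0 ?subr_ge0.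
have e_ge0 : 0 <= (k%:Z - b%:Z - c%:Z - ((i == 0) : nat)%:Z) * (n 0 - n 2%:R).
  by apply: mulr_ge0; [lia | rewrite subr_ge0 (le_trans n12)].
rewrite -md !PoszD; elim/ord3_cases: i e_ge0 {mk} => /= e_ge0; lra.
Qed.

(** With integer multiplicities, the bound m <= (d - 1) / 3 reads 3 m < d. *)
Theorem stable_of_multiplicity (C : numFieldType) (d : nat) (X : vfield C)
    (p : 'cV[C]_3) (m : nat) :
  (2 <= d)%N -> foliation d X -> unique_singular_point X p ->
  algebraic_multiplicity X p m ->
  (3 * m < d)%N \/ ((2 * m <= d)%N /\ ~ (exists F, invariant_line X F)) ->
  stable d X.
Proof.
move=> d2 folX [_ uniqp] Xm cond lambda lam [t1 t10 lam1].
have d0 : (0 < d)%N by lia.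
have [h hu [n [lamh n01 n12 nsum]]] := one_param_subgroup_sorted_diag lam.
have n0 : 0 < n 0.
  rewrite ltNge; apply: contraNN lam1 => n0.
  have nE : forall i, n i = 0 by apply: ord3_cases; lia.
  apply/eqP; rewrite -[LHS](mulmxK hu) lamh//.
  rewrite (_ : diag_mx _ = 1%:M) ?mulmx1 ?mulmxV//.
  by rewrite -diag_const_mx; congr diag_mx; apply/rowP => j; rewrite !mxE nE expr0z.
have det1 : forall t, t != 0 -> \det (lambda t) = 1 by case: lam.
have [mu [Xmu [Y [Yd XY wY]]]] := is_mumford_diag d0 hu det1 lamh folX.
exists mu => //; rewrite ltNge; apply/negP => mu0.
have {}wY i mon : mon \in msupp (Y i 0) -> 0 <= weight n mon i.
  by move/wY; apply: le_trans.
have sing k : n k = n 0 -> exists c, h *m delta_mx k 0 = c *: p.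
  move=> nk; apply: uniqp; apply: (singular_point_transport hu XY).
  apply: (singular_coordinate_point_weight d2 Yd _ _ wY).
    by rewrite nk.
  by rewrite nk; apply: ord3_cases; lia.
have [c hc] := sing 0 erefl.
have delta_neq0 (k : 'I_3) : delta_mx k 0 != 0 :> 'cV[C]_3.
  by apply/eqP => /colP/(_ k)/eqP; rewrite !mxE !eqxx oner_eq0.
have c0 : c != 0.
  apply: contraNneq (delta_neq0 0) => c0.
  by rewrite -(mulKmx hu (delta_mx 0 0)) hc c0 scale0r mulmx0.
have n10 : n 1 != n 0.
  apply/eqP => /sing[c' hc'].
  have : delta_mx 1 0 = (c' / c) *: delta_mx 0 0 :> 'cV[C]_3.
    apply: (can_inj (mulKmx hu)).
    by rewrite -scalemxAr hc hc' scalerA divfK.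
  move/colP/(_ 1)/eqP; rewrite !mxE !eqxx /= mulr0.
  by rewrite oner_eq0.
(* It remains to bound the weight of a monomial of order at most m at p. *)
suff neg : n 1 - d%:Z * n 0 + m%:Z * (n 0 - n 2%:R) < 0.
  apply: (algebraic_multiplicity_lt hu XY c0 hc Xm) => i mon ms.
  rewrite ltnNge; apply/negP => small.
  have /dhomogP/(_ mon ms) /= md := Yd i.
  have := weight_lt0 n01 n12 md neg small.
  by rewrite ltNge wY.
case: cond => [m3|[m2 noline]].
  have : n 1 < n 0 by rewrite lt_neqAle n10.
  nia.
suff n1 : n 1 < 0 by nia.
rewrite ltNge; apply/negP => n1; apply: noline.
apply: (invariant_line_coordinate (k:=2%:R) hu XY) => mon ms.
apply/eqP => mon0; have := wY _ _ ms; rewrite weightE mon0 mul0r addr0.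
nia.
Qed.

Unset Implicit Arguments.

Theorem theorem3p12 (R : realType) (d : nat) (X : vfield R[i])
    (p : 'cV[R[i]]_3) (m : nat) :
  (2 <= d)%N ->
  foliation d X ->
  finite_set (automorphism_group d X) ->
  (forall g h, automorphism_group d X g -> automorphism_group d X h ->
     g *m h = h *m g) ->
  unique_singular_point X p ->
  algebraic_multiplicity X p m ->
  (m%:Q <= (d%:Q - 1) / 3%:Q) \/
  ((d%:Q - 1) / 3%:Q < m%:Q /\ m%:Q <= d%:Q / 2%:Q /\
     ~ (exists F, invariant_line X F)) ->
  stable d X.
Proof.
move=> d2 folX _ _ uniqp Xm cond; apply: stable_of_multiplicity uniqp Xm _ => //.
case: cond => [|[_ [+ noline]]]; rewrite ler_pdivlMr// => bound; [left|right; split=> //].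
  by move: bound; rewrite -[1]/(1%:Q) -intrM -intrB ler_int; lia.
by move: bound; rewrite -intrM ler_int; lia.
Qed.
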